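(* Every connected s-quadrangular graph with at least three vertices contains a 2-factor (a spanning subgraph in which every vertex has degree exactly 2).
   Context: Graphs are finite and simple; $N(x)$ denotes the set of neighbors of a vertex $x$. A set $S$ of vertices is a $q$-set if $|S|\ge 2$ and for every $u\in S$ there is $v\in S$, $v\neq u$, with $N(u)\cap N(v)\neq\emptyset$. A graph is s-quadrangular if for every $q$-set $S$, $\left|\bigcup\{N(u)\cap N(v): u\neq v,\ u,v\in S\}\right|\ge |S|$. (Equivalently, the digraph obtained by replacing each edge $xy$ by the two arcs $xy,yx$ is s-quadrangular in the directed sense.) *)

(* Defs.v *)
From mathcomp Require Import all_boot.

Set Implicit Arguments.
Unset Strict Implicit.
Unset Printing Implicit Defensive.

(* A graph on the finite vertex type T is given by its adjacency relation;
   it is simple when that relation is symmetric and irreflexive. *)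
Definition simple_graph (T : finType) (e : rel T) : Prop :=
  symmetric e /\ irreflexive e.

Definition connected_graph (T : finType) (e : rel T) : Prop :=
  forall x y : T, connect e x y.

Definition nbr (T : finType) (e : rel T) (x : T) : {set T} := [set y | e x y].

Definition qset (T : finType) (e : rel T) (S : {set T}) : Prop :=
  2 <= #|S| /\
  forall u, u \in S ->
    exists v, [/\ v \in S, v != u & nbr e u :&: nbr e v != set0].

Definition s_quadrangular (T : finType) (e : rel T) : Prop :=
  forall S : {set T}, qset e S ->
    #|S| <= #|\bigcup_(u in S) \bigcup_(v in S | u != v)
                 (nbr e u :&: nbr e v)|.

(* f is the adjacency relation of a spanning subgraph of e: it has the same
   vertex type T. *)
Definition two_factor (T : finType) (e f : rel T) : Prop :=
  [/\ simple_graph f, subrel f e & forall x : T, #|nbr f x| = 2].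

(* Main.v *)
Require Import Defs.
From mathcomp Require Import all_boot.
From mathcomp Require Import zify.

Set Implicit Arguments.
Unset Strict Implicit.
Unset Printing Implicit Defensive.

(** Tutte's 1-factor theorem, applied to a gadget graph built on [G], shows that
    if [G] has no 2-factor then there are disjoint sets [S] and [D] and a family
    [P] of disjoint pieces, closed under adjacency outside [S] and [D] and sending
    an odd number of edges to [D], with
    [2|S| + e(D, ~S) < 2|D| + |P|].
    Choose such an obstruction with [|D| + |~S|] minimal.  Let [L] be the vertices
    of [D] without neighbour in [S], [D0 = D \ L] and [P1] the pieces with no
    edge to [D0].  From each member of [P1] pick a vertex adjacent to [D], and let
    [Z] be [D0] plus these vertices.  By minimality and s-quadrangularity each
    vertex of [Z] has a neighbour in [S]; s-quadrangularity of the vertices of [Z]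
    that share a neighbour with another one then bounds [|Z|] by [|S|] plus the
    number of vertices outside [S] with two neighbours in [Z], and counting the
    edges at [D] contradicts the displayed inequality. *)

(** * Perfect matchings *)

(** A perfect matching of [Q] is encoded by its partner function, whose values outside [Q] are
    unconstrained. *)
Definition matchable (V : finType) (g : rel V) (Q : {set V}) : Prop :=
  exists f : V -> V, forall x, x \in Q -> [/\ f x \in Q, f (f x) = x & g x (f x)].

(** A violation of Tutte's condition. A member of [P] may be a union of components left after
    deleting [W]: only odd size and closure under adjacency outside [W] are asked. *)
Definition barrier (V : finType) (g : rel V) (W : {set V}) (P : {set {set V}}) :
    Prop :=
  [/\ trivIset P,
      forall C, C \in P ->
        [/\ odd #|C|, [disjoint C & W] &
            forall x y, x \in C -> g x y -> y \notin W -> y \in C]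
    & #|W| < #|P|].

Lemma fpf_involution_even (V : finType) (f : V -> V) (Q : {set V}) :
  (forall x, x \in Q -> [/\ f x \in Q, f (f x) = x & f x != x]) -> ~~ odd #|Q|.
Proof.
have [n] := ubnP #|Q|; elim: n Q => // n IHn Q leQn fQ.
have [->|[x Qx]] := set_0Vmem Q; first by rewrite cards0.
have [Qfx ffx fxx] := fQ x Qx.
have QfxD : f x \in Q :\ x by rewrite in_setD1 fxx.
rewrite (cardsD1 x) Qx (cardsD1 (f x)) QfxD /= negbK.
apply: IHn => [|y]; first by move: leQn; rewrite (cardsD1 x) Qx (cardsD1 (f x)) QfxD; lia.
rewrite !in_setD1 => /and3P[yfx yx Qy]; have [Qfy ffy fyy] := fQ y Qy.
split=> //; rewrite Qfy andbT; apply/andP; split.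
  by apply: contraNneq yx => fyE; rewrite -ffy fyE ffx.
by apply: contraNneq yfx => fyE; rewrite -ffy fyE.
Qed.

(** Cancelling a step at each end turns an equality for [k + 2] at [x] into one for [k] at
    [f2 (f1 x)]; for [k = 0] or [k = 1] it would give a fixed point of [f2] or [f1]. *)
Lemma alternating_parity (V : Type) (f1 f2 : V -> V) k x :
  involutive f1 -> involutive f2 ->
  (forall y, f1 y <> y) -> (forall y, f2 y <> y) ->
  iter k (f2 \o f1) x <> f2 x.
Proof.
move=> f1K f2K f1N f2N; have [n] := ubnP k; elim: n k x => // n IHn [|[|k]] x lt_kn.
- by move=> /esym/f2N.
- by move=> /= /(can_inj f2K)/f1N.
- move=> eq_x; apply: (IHn k ((f2 \o f1) x)); first by lia.
  rewrite -iterSr /= f2K; apply: (can_inj f1K); apply: (can_inj f2K).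
  by move: eq_x; rewrite f1K.
Qed.

(* The new matching is [f1] on the alternating path from [d] to [a], the edge [ab],
   and [f2] elsewhere. *)
Lemma exchange_along_path (V : finType) (g : rel V) (a b c d : V) (f1 f2 : V -> V) k :
  symmetric g -> irreflexive g -> g a b ->
  involutive f1 -> involutive f2 ->
  (forall y, f1 y <> y) -> (forall y, f2 y <> y) ->
  f1 a = c -> f2 b = d ->
  (forall x, x != a -> x != c -> g x (f1 x)) ->
  (forall x, x != b -> x != d -> g x (f2 x)) ->
  iter k (f2 \o f1) d = a ->
  (forall i, i < k -> iter i (f2 \o f1) d != a /\ iter i (f2 \o f1) d != c) ->
  matchable g setT.
Proof.
move=> gS gI gab f1K f2K f1N f2N f1a f2b gf1 gf2 pk pmin.
set p := f2 \o f1 in pk pmin.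
pose D := [set x | [exists i : 'I_k, x == iter i p d]].
have DP x : reflect (exists2 i, i < k & x = iter i p d) (x \in D).
  rewrite inE; apply: (iffP existsP) => [[i /eqP->]|[i ltik ->]]; first by exists i.
  by exists (Ordinal ltik).
(* [D] holds the points [iter i p d] before the walk reaches [a]; with their [f1]-partners they are
   all the vertices of the path except [a]. *)
pose X := [set x | (x \in D) || (f1 x \in D)].
have inX x : (x \in X) = (x \in D) || (f1 x \in D) by rewrite inE.
have f1X x : (f1 x \in X) = (x \in X) by rewrite !inX f1K orbC.
have aX : a \notin X.
  rewrite inX; apply/norP; split; apply/DP => -[i /pmin[ia ic]];
    first by move/eqP; rewrite eq_sym (negbTE ia).
  by rewrite f1a => /eqP; rewrite eq_sym (negbTE ic).
have cX : c \notin X by rewrite -f1a f1X.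
(* Parity keeps [b] out of [D]. If [f1 b] were in [D], the walk would return to [d] and hence reach
   [a] in fewer than [k] steps. *)
have bX : b \notin X.
  rewrite inX; apply/norP; split; apply/DP => -[i ltik].
    move=> bE; case: (@alternating_parity _ f1 f2 i d) => //.
    by rewrite -[f2 \o f1]/p -bE -f2b f2K.
  move=> f1b; have dE : iter i.+1 p d = d by rewrite iterS -f1b /p /= f1K f2b.
  have [] : iter (k - i.+1) p d != a /\ iter (k - i.+1) p d != c by apply: pmin; lia.
  by rewrite -[X in iter _ _ X]dE -iterD subnK // pk eqxx.
have f2d : f2 d = b by rewrite -f2b f2K.
(* [f2] leaves [X] only at the two ends of the path, towards [a] and [b]; so off [X], [a] and [b] it
   can be kept unchanged. *)
have XU x : x \in X -> f2 x \in X \/ f2 x = a \/ f2 x = b.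
  rewrite inX => /orP[] /DP[[|i] ltik xE].
  - by right; right; rewrite xE.
  - by left; rewrite inX xE /= f2K f1K; apply/orP; right; apply/DP; exists i => //; lia.
  - have [k1|k1] := eqVneq 1 k; first by right; left; rewrite -pk -k1 /= /p /= -[d]xE f1K.
    left; rewrite inX; apply/orP; left; apply/DP; exists 1; first by lia.
    by rewrite /= /p /= -[d]xE f1K.
  - have f2x : f2 x = iter i.+2 p d by rewrite iterS -xE /p /= f1K.
    have [k1|k1] := eqVneq i.+2 k; first by right; left; rewrite f2x k1.
    by left; rewrite inX; apply/orP; left; apply/DP; exists i.+2 => //; lia.
have ab : a != b by apply: contraTneq gab => ->; rewrite gI.
exists (fun x => if x \in X then f1 x else if x == a then b else if x == b then a else f2 x).
move=> x _; rewrite in_setT.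
have [xX|xX] := boolP (x \in X).
  rewrite f1X xX f1K; split=> //; apply: gf1; first by apply: contraNneq aX => <-.
  by apply: contraNneq cX => <-.
have [->|xa] := eqVneq x a; first by rewrite (negbTE bX) eq_sym (negbTE ab) eqxx.
have [->|xb] := eqVneq x b; first by rewrite (negbTE aX) eqxx gS.
have Xf2 : f2 x \notin X by apply: contraNN xX => f2X;
  case: (XU _ f2X); rewrite f2K // => -[] xE; [move: xa|move: xb]; rewrite xE eqxx.
have fxb : f2 x != b.
  apply: contraNneq xX => fxb; have xd : x = d by rewrite -f2b -fxb f2K.
  have [k0|k0] := posnP k; first by move: xa; rewrite xd -pk k0 eqxx.
  by rewrite inX; apply/orP; left; apply/DP; exists 0.
have fxa : f2 x != a.
  apply: contraNneq xX => fxa; have {fxa}xE : x = f2 a by rewrite -fxa f2K.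
  have [k0|k0] := posnP k; first by move: xb; rewrite xE -pk k0 f2d eqxx.
  rewrite inX; apply/orP; right; apply/DP; exists k.-1; first by lia.
  by rewrite xE -pk -[in f2 _](prednK k0) iterS /p /= f2K f1K.
rewrite (negbTE Xf2) (negbTE fxa) (negbTE fxb) f2K; split=> //; apply: gf2 => //.
by apply: contraNneq fxb => ->; rewrite f2d.
Qed.

(* [f1] and [f2] are perfect matchings of [g] plus the edge [ac] and of [g] plus
   the edge [bd]. *)
Lemma exchange (V : finType) (g : rel V) (a b c d : V) (f1 f2 : V -> V) :
  symmetric g -> irreflexive g -> g a b -> g b c ->
  involutive f1 -> involutive f2 ->
  (forall y, f1 y <> y) -> (forall y, f2 y <> y) ->
  f1 a = c -> f2 b = d ->
  (forall x, x != a -> x != c -> g x (f1 x)) ->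
  (forall x, x != b -> x != d -> g x (f2 x)) ->
  matchable g setT.
Proof.
move=> gS gI gab gbc f1K f2K f1N f2N f1a f2b gf1 gf2.
set p := f2 \o f1.
(* Follow the alternating walk from [d]. If it meets [a] or [c], the first visit ends a path for
   [exchange_along_path]. *)
have [/existsP[x /andP[dx xac]]|none] :=
    boolP [exists x, fconnect p d x && ((x == a) || (x == c))].
  have ex_k : exists k, (iter k p d == a) || (iter k p d == c).
    by exists (findex p d x); rewrite (iter_findex dx).
  case: (ex_minnP ex_k) => k pk kmin.
  have pmin i : i < k -> iter i p d != a /\ iter i p d != c.
    by move=> ltik; apply/andP; rewrite -negb_or; apply: contraTN ltik => /kmin; rewrite -leqNgt.
  case/orP: pk => /eqP pk; first exact: (exchange_along_path (k := k) gS gI gab _ _ _ _ f1a f2b).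
  (* When [c] comes first, [a] and [c] swap roles and the edge [bc] replaces [ab]. *)
  apply: (exchange_along_path (k := k) (a := c) (c := a) gS gI _ f1K f2K f1N f2N _ f2b) => //.
  - by rewrite gS.
  - by rewrite -f1a f1K.
  - by move=> y yc ya; apply: gf1.
  - by move=> i /pmin[].
have orbitN x : fconnect p d x -> x != a /\ x != c.
  move=> dx; apply/andP; rewrite -negb_or; apply: contraNN none => xac.
  by apply/existsP; exists x; rewrite dx.
have pI : injective p by apply: inj_comp; apply: can_inj; eassumption.
have pS : connect_sym (frel p) by exact: fconnect_sym.
have f2d : f2 d = b by rewrite -f2b f2K.
(* The alternating component of [bd] avoids [ac]: use [f1] on it and [f2] elsewhere. *)
pose X := [set x | fconnect p d x || fconnect p d (f1 x)].
have f1X x : (f1 x \in X) = (x \in X) by rewrite !inE f1K orbC.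
have connp x : fconnect p d (p x) = fconnect p d x.
  by rewrite (same_connect_r pS (fconnect1 p x)).
have f2X x : (f2 x \in X) = (x \in X).
  rewrite !inE orbC -connp /p /= f1K f2K; congr (_ || _).
  by rewrite -[in RHS]connp /= /p /= f1K.
have dX : d \in X by rewrite inE connect0.
have bX : b \in X by rewrite -f2d f2X.
exists (fun x => if x \in X then f1 x else f2 x) => x _; rewrite in_setT.
have [xX|xX] := boolP (x \in X).
  rewrite f1X xX f1K; split=> //; apply: gf1.
    apply: contraTneq xX => ->; rewrite inE f1a.
    by apply/norP; split; apply/negP => /orbitN[]; rewrite !eqxx.
  apply: contraTneq xX => ->; rewrite inE -f1a f1K.
  by apply/norP; split; apply/negP => /orbitN[]; rewrite ?f1a !eqxx.
rewrite f2X (negbTE xX) f2K; split=> //; apply: gf2; first by apply: contraNneq xX => ->.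
by apply: contraNneq xX => ->.
Qed.

(** * Saturated graphs and Tutte's theorem *)

Lemma matchableU (V : finType) (g : rel V) (A B : {set V}) :
  [disjoint A & B] -> matchable g A -> matchable g B -> matchable g (A :|: B).
Proof.
move=> dAB [f fA] [h hB]; exists (fun x => if x \in A then f x else h x) => x.
rewrite inE; have [xA _|xA /= xB] := boolP (x \in A).
  by have [fx ffx gx] := fA x xA; rewrite fx inE fx.
have [hx hhx gx] := hB x xB; have /negbTE hxA : h x \notin A by rewrite (disjointFl dAB).
by rewrite hxA inE hx orbT.
Qed.

Lemma matchable2 (V : finType) (g : rel V) (x y : V) :
  symmetric g -> g x y -> x != y -> matchable g [set x; y].
Proof.
move=> gS gxy xy; have /negbTE yx : y != x by rewrite eq_sym.
exists (fun z => if z == x then y else x) => z.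
by rewrite !inE => /orP[] /eqP->; rewrite ?eqxx ?yx ?eqxx ?orbT // gS.
Qed.

Lemma matchable_pairU (V : finType) (g : rel V) (Q : {set V}) (x y : V) :
  symmetric g -> g x y -> x != y -> x \in Q -> y \in Q ->
  matchable g (Q :\: [set x; y]) -> matchable g Q.
Proof.
move=> gS gxy xy xQ yQ mQ; rewrite -(setID Q [set x; y]).
rewrite (setIidPr _); last by apply/subsetP => z; rewrite !inE => /orP[]/eqP->.
apply: matchableU => //; last exact: matchable2.
by rewrite -setI_eq0; apply/eqP/setP => z; rewrite !inE; case: (z == x); case: (z == y).
Qed.

Lemma cardsD2 (V : finType) (Q : {set V}) (x y : V) :
  x != y -> x \in Q -> y \in Q -> #|Q| = #|Q :\: [set x; y]|.+2.
Proof.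
move=> xy xQ yQ; rewrite (cardsD1 x) xQ (cardsD1 y) !inE eq_sym xy yQ /= addnA.
by congr (_.+2); apply: eq_card => z; rewrite !inE negb_or andbA [(z != y) && _]andbC.
Qed.

Definition universal (V : finType) (g : rel V) : {set V} :=
  [set u | [forall v, (v != u) ==> g u v]].

Lemma universalP (V : finType) (g : rel V) u v :
  u \in universal g -> v != u -> g u v.
Proof. by rewrite inE => /forallP/(_ v)/implyP. Qed.

(** Each vertex of [B] takes a partner in [U]; the rest of [U] is a clique of even size and is
    paired off within itself. *)
Lemma matchable_universal (V : finType) (g : rel V) (B U : {set V}) :
  symmetric g -> U \subset universal g -> [disjoint B & U] ->
  #|B| <= #|U| -> ~~ odd (#|B| + #|U|) -> matchable g (B :|: U).
Proof.
move=> gS; have [n] := ubnP #|U|; elim: n U B => // n IHn U B ltU /subsetP uniU dBU leBU evBU.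
have [B0|[b bB]] := set_0Vmem B.
  have [->|[x xU]] := set_0Vmem U.
    by rewrite B0 setU0; exists id => y; rewrite inE.
  have [U0|[y]] := set_0Vmem (U :\ x).
    by move: evBU; rewrite B0 cards0 (cardsD1 x) xU U0 cards0.
  rewrite in_setD1 => /andP[yx yU].
  have xy : x != y by rewrite eq_sym.
  rewrite B0 set0U; apply: (matchable_pairU (x := x) (y := y)) => //.
    by apply: universalP yx; apply: uniU.
  rewrite -[_ :\: _]set0U -B0; have cU := cardsD2 xy xU yU; apply: IHn.
  - by lia.
  - by apply/subsetP => z; rewrite inE => /andP[_ /uniU].
  - by rewrite B0 -setI_eq0 set0I.
  - by rewrite B0 cards0.
  - by move: evBU; rewrite cU !addnS /= negbK.
have [U0|[u uU]] := set_0Vmem U.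
  by move: leBU; rewrite U0 cards0 (cardsD1 b) bB.
have bu : b != u by apply: contraTneq uU => <-; rewrite (disjointFr dBU).
have gbu : g b u by rewrite gS; apply: universalP bu; apply: uniU.
have bU : b \notin U by rewrite (disjointFr dBU).
have uB : u \notin B by rewrite (disjointFl dBU).
apply: (matchable_pairU (x := b) (y := u)); rewrite ?inE ?bB ?uU ?orbT //.
have -> : (B :|: U) :\: [set b; u] = (B :\ b) :|: (U :\ u).
  apply/setP => z; rewrite !inE; have [->|zb] := eqVneq z b.
    by rewrite (negbTE bU) andbF.
  by have [->|zu] := eqVneq z u; rewrite ?(negbTE uB).
have cU : #|U| = #|U :\ u|.+1 by rewrite (cardsD1 u) uU.
have cB : #|B| = #|B :\ b|.+1 by rewrite (cardsD1 b) bB.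
apply: IHn; [by lia | | | by lia | by move: evBU; rewrite cU cB addnS addSn /= negbK].
- by apply/subsetP => z; rewrite inE => /andP[_ /uniU].
- by apply: disjointWl (subsetDl _ _) _; apply: disjointWr (subsetDl _ _) _.
Qed.

(** Greedy choice: adjacent pairs are set aside until the remaining vertices are independent. *)
Lemma matchable_max (V : finType) (g : rel V) (Q : {set V}) :
  symmetric g -> irreflexive g ->
  exists A : {set V}, [/\ A \subset Q, matchable g A &
    forall x y, x \in Q :\: A -> y \in Q :\: A -> ~~ g x y].
Proof.
move=> gS gI; have [n] := ubnP #|Q|; elim: n Q => // n IHn Q ltQ.
have [/existsP[x /existsP[y /and3P[xQ yQ gxy]]]|none] :=
  boolP [exists x, exists y, [&& x \in Q, y \in Q & g x y]]; last first.
  exists set0; rewrite sub0set setD0; split=> //; first by exists id => z; rewrite inE.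
  move=> x y xQ yQ; apply: contraNN none => gxy.
  by apply/existsP; exists x; apply/existsP; exists y; rewrite xQ yQ.
have xy : x != y by apply: contraTneq gxy => ->; rewrite gI.
have [|A [AQ mA indA]] := IHn (Q :\: [set x; y]); first by have := cardsD2 xy xQ yQ; lia.
have A2 : (x \notin A) && (y \notin A).
  by apply/andP; split; apply/negP => /(subsetP AQ); rewrite !inE eqxx ?orbT.
case/andP: A2 => xA yA.
exists (A :|: [set x; y]); split.
- rewrite subUset (subset_trans AQ (subsetDl _ _)) /=.
  by apply/subsetP => z; rewrite !inE => /orP[]/eqP->.
- apply: matchableU => //; last exact: matchable2.
  by rewrite -setI_eq0; apply/eqP/setP => z; rewrite !inE; apply/negbTE/negP=> /andP[zA /orP[]/eqP zE];
    move: zA; rewrite zE (negbTE xA, negbTE yA).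
- by move=> z t zQ tQ; apply: indA; rewrite setDDl setUC.
Qed.

(** The last hypothesis makes adjacency transitive through non-universal vertices, so outside [U]
    the graph is a disjoint union of cliques. A maximal matching there leaves at most one vertex of
    each clique; these form [B]. Either [U] absorbs [B], or the cliques meeting [B] are more odd
    pieces than [U] has vertices. *)
Lemma tutte_saturated (V : finType) (g : rel V) :
  symmetric g -> irreflexive g -> ~~ odd #|V| ->
  (forall a b c, b \notin universal g -> g a b -> g b c -> a != c -> g a c) ->
  matchable g setT \/ exists W P, barrier g W P.
Proof.
move=> gS gI evV tr; set U := universal g.
have [A [AU mA indA]] := matchable_max (~: U) gS gI.
set B := ~: U :\: A in indA.
have dAU : [disjoint A & U] by rewrite disjoints_subset.
have UAB : A :|: (B :|: U) = setT.
  apply/setP => x; rewrite !inE; have := subsetP AU x; rewrite !inE.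
  by case: (x \in A) => // _; case: [forall v, _].
have dBU : [disjoint B & U] by rewrite disjoints_subset subsetDl.
have dABU : [disjoint A & B :|: U].
  rewrite disjoints_subset; apply/subsetP => x xA; rewrite inE in_setU (disjointFr dAU xA) orbF.
  by rewrite inE xA.
have evA : ~~ odd #|A|.
  case: mA => f fA; apply: (fpf_involution_even (f := f)) => x /fA[? ? gx].
  by split=> //; apply: contraTneq gx => ->; rewrite gI.
have cV : #|V| = #|A| + (#|B| + #|U|).
  rewrite -cardsT -UAB cardsU (disjoint_setI0 dABU) cards0 subn0.
  by rewrite cardsU (disjoint_setI0 dBU) cards0 subn0.
have [leBU|ltUB] := leqP #|B| #|U|.
  left; rewrite -UAB; apply: matchableU => //; apply: matchable_universal => //.
  by move: evV; rewrite cV oddD (negbTE evA).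
(* [cls b] is the clique of [b] outside [U]. It is odd because its vertices other than [b] are
   matched among themselves. *)
right; pose cls b := [set x in ~: U | (x == b) || g b x].
have notU b : b \in B -> b \notin U by move=> bB; rewrite (disjointFr dBU).
have clsb b : b \in B -> b \in cls b by move=> /notU bU; rewrite in_set in_setC bU eqxx.
have clsU b x : x \in cls b -> x \notin U by rewrite in_set in_setC => /andP[].
have clsE b x y : x \in cls b -> g x y -> y \notin U -> y \in cls b.
  rewrite in_set in_setC => /andP[xU xb] gxy yU; rewrite in_set in_setC yU /=.
  have [//|yb] := eqVneq y b; case/orP: xb => [/eqP<- //|gbx] /=.
  by apply: tr gbx gxy _ => //; rewrite eq_sym.
have clsB b b' x : b \in B -> b' \in B -> x \in cls b -> x \in cls b' -> b = b'.
  move=> bB b'B xb xb'; apply/eqP; apply/negPn/negP => bb'.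
  have := clsE b' x b xb'; have [xbE|xbN] := eqVneq x b.
    by move: xb'; rewrite xbE in_set in_setC (negbTE bb') (notU b) //= gS (negbTE (indA _ _ bB b'B)).
  move: xb; rewrite in_set in_setC (negbTE xbN) /= => /andP[_ gbx].
  rewrite gS => /(_ gbx (notU _ bB)).
  by rewrite in_set in_setC (negbTE bb') gS (negbTE (indA _ _ bB b'B)) andbF.
exists U, (cls @: B); split.
- apply/trivIsetP => _ _ /imsetP[b bB ->] /imsetP[b' b'B ->] bb'.
  rewrite disjoints_subset; apply/subsetP => x xb; rewrite inE.
  by apply: contraNN bb' => xb'; rewrite (clsB b b' x).
- move=> _ /imsetP[b bB ->]; split.
  + rewrite (cardsD1 b) clsb //=; case: mA => f fA.
    apply: (fpf_involution_even (f := f)) => x; rewrite in_setD1 => /andP[xb xC].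
    have xA : x \in A.
      apply/negPn/negP => xA; have xB : x \in B by rewrite in_setD xA in_setC (clsU b).
      move: xC; rewrite in_set (negbTE xb) in_setC (notU x xB) /=.
      by rewrite (negbTE (indA _ _ bB xB)).
    have [fx ffx gx] := fA x xA; split=> //; last by apply: contraTneq gx => ->; rewrite gI.
    rewrite in_setD1 (clsE b x) ?andbT //; last by rewrite (disjointFr dAU).
    by apply: contraTneq fx => ->; move: bB; rewrite inE => /andP[].
  + rewrite disjoints_subset; apply/subsetP => x /clsU; by rewrite in_setC.
  + by move=> x y; apply: clsE.
- rewrite card_in_imset // => b b' bB b'B eqc.
  by apply: (clsB b b' b) => //; rewrite -?eqc clsb.
Qed.

Definition add_edge (V : eqType) (g : rel V) (a c : V) : rel V :=
  fun x y => [|| g x y, (x == a) && (y == c) | (x == c) && (y == a)].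

Lemma add_edge_sym (V : eqType) (g : rel V) a c : symmetric g -> symmetric (add_edge g a c).
Proof. by move=> gS x y; rewrite /add_edge gS; congr (_ || _); rewrite orbC; congr (_ || _);
  rewrite andbC. Qed.

Lemma add_edge_irr (V : eqType) (g : rel V) a c :
  a != c -> irreflexive g -> irreflexive (add_edge g a c).
Proof.
move=> ac gI x; rewrite /add_edge gI /=.
by have [->|] := eqVneq x a; rewrite ?(negbTE ac) ?andbF.
Qed.

Lemma barrier_sub (V : finType) (g h : rel V) W P : subrel g h -> barrier h W P -> barrier g W P.
Proof.
move=> gh [tP oP cP]; split=> // C /oP[oC dC clC]; split=> // x y xC /gh; exact: clC.
Qed.

Lemma add_edge_matching (V : finType) (g : rel V) a c :
  symmetric g -> irreflexive g -> a != c ->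
  matchable (add_edge g a c) setT ->
  matchable g setT \/
  exists f, [/\ involutive f, forall x, f x <> x, f a = c &
    forall x, x != a -> x != c -> g x (f x)].
Proof.
move=> gS gI ac [f fT]; have fK : involutive f by move=> x; have [] := fT x (in_setT x).
have gf x : add_edge g a c x (f x) by have [] := fT x (in_setT x).
have [fac|fac] := eqVneq (f a) c; [right|left]; exists f; last first.
  move=> x _; split=> //; have /or3P[// |/andP[/eqP-> /eqP fE]|/andP[/eqP-> /eqP fE]] := gf x.
    by rewrite fE eqxx in fac.
  by rewrite -fE fK eqxx in fac.
split=> //.
- by move=> x fx; have := gf x; rewrite fx add_edge_irr.
- by move=> x xa xc; have := gf x; rewrite /add_edge (negbTE xa) (negbTE xc) /= orbF.
Qed.

(** Induction on the number of non-adjacent pairs: adding an edge gives a barrier, which is also one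
    for [g], or a perfect matching. If [g] is not saturated, there are a path [a], [b], [c] and a
    vertex [d] with [ac] and [bd] missing, and the matchings obtained with either edge added are
    combined by [exchange]. *)
Lemma tutte (V : finType) (g : rel V) :
  symmetric g -> irreflexive g -> ~~ odd #|V| ->
  matchable g setT \/ exists W P, barrier g W P.
Proof.
move=> + + evV; pose nonadj (h : rel V) := #|[set xy : V * V | ~~ h xy.1 xy.2]|.
have [n] := ubnP (nonadj g); elim: n g => // n IHn g ltg gS gI.
have add a c : a != c -> ~~ g a c -> matchable (add_edge g a c) setT \/ exists W P, barrier g W P.
  move=> ac gac; have [||||[W [P bP]]] := IHn (add_edge g a c).
  - rewrite -ltnS; apply: leq_trans ltg; rewrite ltnS; apply: proper_card; apply/properP; split.
      by apply/subsetP => -[x y]; rewrite !inE /add_edge /= negb_or => /andP[].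
    by exists (a, c); rewrite !inE /add_edge //= !eqxx orbT.
  - exact: add_edge_sym.
  - exact: add_edge_irr.
  - by left.
  - by right; exists W, P; apply: barrier_sub bP => x y; rewrite /add_edge => ->.
have [/existsP[b /andP[bU /existsP[a /existsP[c /and4P[gab gbc ac gac]]]]]|none] := boolP
  [exists b, (b \notin universal g) &&
    [exists a, exists c, [&& g a b, g b c, a != c & ~~ g a c]]]; last first.
  apply: tutte_saturated => // a b c bU gab gbc ac; apply: contraNT none => gac.
  apply/existsP; exists b; rewrite bU; apply/existsP; exists a; apply/existsP; exists c.
  by rewrite gab gbc ac.
have [d bd gbd] : exists2 d, b != d & ~~ g b d.
  move: bU; rewrite inE negb_forall => /existsP[d]; rewrite negb_imply eq_sym => /andP[? ?].
  by exists d.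
have [mac|] := add a c ac gac; last by right.
have [mbd|] := add b d bd gbd; last by right.
left; have [//|[f1 [f1K f1N f1a gf1]]] := add_edge_matching gS gI ac mac.
have [//|[f2 [f2K f2N f2b gf2]]] := add_edge_matching gS gI bd mbd.
exact: (exchange gS gI gab gbc f1K f2K f1N f2N f1a f2b gf1 gf2).
Qed.

(** * Barriers with surplus pieces *)

Lemma odd_card_cover (V : finType) (P : {set {set V}}) :
  trivIset P -> (forall C, C \in P -> odd #|C|) -> odd #|cover P| = odd #|P|.
Proof.
move=> /eqP <- oP; rewrite -sum1_card.
by apply: (big_ind2 (fun m n => odd m = odd n)) => [|m1 m2 n1 n2|C /oP->] //; rewrite !oddD => -> ->.
Qed.

(** By parity: if [P] exceeds [W] by exactly one, the set [R] of remaining vertices is odd and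
    serves as a further piece. *)
Lemma barrier_gap (V : finType) (g : rel V) (W : {set V}) (P : {set {set V}}) :
  symmetric g -> ~~ odd #|V| -> barrier g W P ->
  exists2 P', barrier g W P' & #|W| + 2 <= #|P'|.
Proof.
move=> gS evV bP; have [tP oP ltWP] := bP.
have [le2|] := leqP (#|W| + 2) #|P|; first by exists P.
move=> lt2; have cP : #|P| = #|W|.+1 by lia.
pose R := ~: (W :|: cover P).
have dWP : [disjoint W & cover P].
  by apply/bigcup_disjointP => C /oP[_ dC _]; rewrite disjoint_sym.
have oR : odd #|R|.
  have := cardsC (W :|: cover P); rewrite cardsU (disjoint_setI0 dWP) cards0 subn0.
  move=> /(congr1 odd); rewrite !oddD (negbTE evV) (odd_card_cover tP); last by move=> C /oP[].
  by rewrite cP /=; case: (odd #|W|); case: (odd _).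
have RnP : R \notin P.
  apply: contraTN oR => RP; suff -> : R = set0 by rewrite cards0.
  apply/eqP; rewrite -subset0; apply/subsetP => x xR; move: (xR); rewrite !inE.
  by rewrite negb_or; case/andP=> _ /negP[]; apply/bigcupP; exists R.
have dR C : C \in P -> [disjoint R & C].
  move=> CP; rewrite disjoints_subset setCS; apply/subsetP => x xC.
  by rewrite inE; apply/orP; right; apply/bigcupP; exists C.
exists (R |: P); last by rewrite cardsU1 RnP; lia.
split; last by rewrite cardsU1 RnP; lia.
- apply/trivIsetP => A B; rewrite !in_setU1 => /predU1P[->|AP] /predU1P[->|BP].
  + by rewrite eqxx.
  + by move=> _; apply: dR.
  + by move=> _; rewrite disjoint_sym dR.
  + by move=> AB; apply: (trivIsetP tP).
- move=> C; rewrite in_setU1 => /predU1P[->|/oP //]; split=> //.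
    by rewrite disjoints_subset setCS subsetUl.
  move=> x y; rewrite !inE !negb_or => /andP[xW xP] gxy yW; rewrite yW /=.
  apply: contra xP => /bigcupP[C' C'P yC']; apply/bigcupP; exists C' => //.
  by have [_ _ clC'] := oP _ C'P; apply: (clC' y) => //; rewrite gS.
Qed.

(** If [w] is adjacent to no pieces but [A] and [B], deleting [w] from [W] and both pieces from [P]
    leaves a barrier, thanks to the surplus of two. Once this is impossible, every vertex of [W] is
    adjacent to at least three pieces. *)
Lemma tight_barrier (V : finType) (g : rel V) (W : {set V}) (P : {set {set V}}) :
  symmetric g -> ~~ odd #|V| -> barrier g W P ->
  exists W' P', barrier g W' P' /\
    forall w A B, w \in W' ->
      exists C x, [/\ C \in P', C != A, C != B, x \in C & g w x].
Proof.
move=> gS evV; have [n] := ubnP #|W|; elim: n W P => // n IHn W P0 ltW /(barrier_gap gS evV)[P bP gapP].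
have [tP oP _] := bP.
have [/existsP[w /andP[wW /existsP[A /existsP[B none]]]]|all] := boolP [exists w, (w \in W) &&
  [exists A : {set V}, [exists B : {set V}, ~~
   [exists C : {set V}, exists x, [&& C \in P, C != A, C != B, x \in C & g w x]]]]]; last first.
  exists W, P; split=> // w A B wW; move: all; rewrite negb_exists => /forallP/(_ w).
  rewrite wW /= negb_exists => /forallP/(_ A); rewrite negb_exists => /forallP/(_ B).
  by rewrite negbK => /existsP[C /existsP[x /and5P[]]]; exists C, x.
have cW : #|W| = #|W :\ w|.+1 by rewrite (cardsD1 w) wW.
apply: (IHn (W :\ w) (P :\: [set A; B])); first by lia.
split.
- by apply: trivIsetS tP; apply: subsetDl.
- move=> C; rewrite !inE negb_or => /andP[/andP[CA CB] CP]; have [oC dC clC] := oP C CP.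
  split=> //; first by apply: disjointWr dC; apply: subsetDl.
  move=> x y xC gxy; rewrite in_setD1 negb_and negbK => /orP[/eqP yw|]; last exact: clC gxy.
  case/negP: none; apply/existsP; exists C; apply/existsP; exists x.
  by rewrite CP CA CB xC gS -yw.
- have le2 : #|P :&: [set A; B]| <= 2.
    by apply: leq_trans (subset_leq_card (subsetIr _ _)) _; rewrite cards2; case: (A != B).
  rewrite -(ltn_add2l #|P :&: [set A; B]|) cardsID; apply: leq_trans gapP. lia.
Qed.

(** * Obstructions to a 2-factor *)

(** Ordered pairs are counted, so an edge inside both sets counts twice. For disjoint [S] and [D],
    [edges e D (~: S)] is the degree sum over [D] after deleting [S]. *)
Definition edges (T : finType) (e : rel T) (A B : {set T}) : nat :=
  \sum_(x in A) \sum_(y in B) e x y.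

Lemma edges_sym (T : finType) (e : rel T) A B : symmetric e -> edges e A B = edges e B A.
Proof.
by move=> eS; rewrite /edges exchange_big; apply: eq_bigr => x _; apply: eq_bigr => y _; rewrite eS.
Qed.

Lemma edges_setID (T : finType) (e : rel T) (A B C : {set T}) :
  edges e A B = edges e A (B :&: C) + edges e A (B :\: C).
Proof. by rewrite /edges -big_split; apply: eq_bigr => x _ /=; rewrite (big_setID C). Qed.

Definition odd_piece (T : finType) (e : rel T) (S D C : {set T}) : Prop :=
  [/\ [disjoint C & S :|: D], odd (edges e D C) &
      forall x y, x \in C -> e x y -> y \notin S :|: D -> y \in C].

(* In Tutte's 2-factor condition, [P] would be the set of all components [C] of
   [G - S - D] with [edges D C] odd; here its members may be unions of components. *)
Definition obstruction (T : finType) (e : rel T) (S D : {set T}) (P : {set {set T}}) :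
    Prop :=
  [/\ [disjoint S & D], trivIset P, forall C, C \in P -> odd_piece e S D C
    & 2 * #|S| + edges e D (~: S) < 2 * #|D| + #|P| ].

(** * The gadget graph *)

Definition dart (T : finType) (e : rel T) := {d : T * T | e d.1 d.2}.

(* Two copies of each vertex and one vertex per dart; the darts that a perfect
   matching joins to vertex copies form a 2-factor. *)
Definition gadget (T : finType) (e : rel T) : rel ((T * bool) + dart e) :=
  fun x y => match x, y with
  | inl _, inl _ => false
  | inl u, inr d => (val d).1 == u.1
  | inr d, inl u => (val d).1 == u.1
  | inr d, inr d' => ((val d).1 == (val d').2) && ((val d).2 == (val d').1)
  end.

Lemma gadget_sym (T : finType) (e : rel T) : symmetric (@gadget T e).
Proof.
by move=> [u|d] [v|d'] //=; rewrite [_ == (val d').2]eq_sym [_ == (val d').1]eq_sym andbC.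
Qed.

Lemma gadget_irr (T : finType) (e : rel T) : irreflexive e -> irreflexive (@gadget T e).
Proof.
move=> eI [//|d] /=; apply/negP => /andP[/eqP dE _].
by have := valP d; rewrite /= dE eI.
Qed.

Definition rev_dart (T : finType) (e : rel T) (eS : symmetric e) (d : dart e) : dart e :=
  Sub ((val d).2, (val d).1) (etrans (eS _ _) (valP d)).

Lemma rev_dartK (T : finType) (e : rel T) (eS : symmetric e) : involutive (@rev_dart T e eS).
Proof. by move=> d; apply: val_inj; case: d => -[]. Qed.

Lemma rev_dart_neq (T : finType) (e : rel T) (eS : symmetric e) (d : dart e) :
  irreflexive e -> rev_dart eS d != d.
Proof.
move=> eI; apply/eqP => /(congr1 val)/(congr1 fst)/= dE.
by have := valP d; rewrite /= dE eI.
Qed.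

Lemma gadget_even (T : finType) (e : rel T) :
  symmetric e -> irreflexive e -> ~~ odd #|{: (T * bool) + dart e}|.
Proof.
move=> eS eI; rewrite -cardsT.
apply: (fpf_involution_even (f := fun x : (T * bool) + dart e =>
  match x with inl u => inl (u.1, ~~ u.2) | inr d => inr (rev_dart eS d) end)).
move=> [[u b]|d] _; split; rewrite ?inE ?negbK ?rev_dartK //.
  by apply/eqP => -[]; case: b.
by rewrite (inj_eq (@inr_inj _ _)) rev_dart_neq.
Qed.

Lemma gadget_matching (T : finType) (e : rel T) :
  symmetric e -> irreflexive e -> matchable (@gadget T e) setT -> exists f, two_factor e f.
Proof.
move=> eS eI [m mT].
have mK : involutive m by move=> x; have [] := mT x (in_setT x).
have gm x : gadget x (m x) by have [] := mT x (in_setT x).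
(* [nb u b] is the head of the dart matched with the copy [(u, b)]. The default [u] never occurs, as
   copies are adjacent to darts only. *)
pose nb u b := if m (inl (u, b)) is inr d then (val d).2 else u.
have nbP u b : exists d : dart e, [/\ m (inl (u, b)) = inr d, (val d).1 = u & (val d).2 = nb u b].
  have := gm (inl (u, b)); rewrite /nb; case: (m _) => //= d /eqP; by exists d.
have enb u b : e u (nb u b) by have [d [_ <- <-]] := nbP u b; exact: (valP d).
pose F : rel T := fun u v => (v == nb u false) || (v == nb u true).
have FP u v : reflect (exists b, v = nb u b) (F u v).
  apply: (iffP orP) => [[] /eqP-> |[[] ->]]; [by exists false|by exists true|by right|by left].
have Fe : subrel F e by move=> u v /FP[b ->].
(* The dart from [u] to [v] is matched with a copy of [u], so its reverse is not its partner and
   must be matched with a copy of [v]. *)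
have Fsym u v : F u v -> F v u.
  case/FP=> b vE; have [d [md d1 d2]] := nbP u b; have := gm (inr (rev_dart eS d)).
  case Em : (m _) => [[w b']|d'] /=.
    move=> /eqP wE; apply/FP; exists b'; rewrite vE -d2 wE /nb /= -Em mK /=; exact: esym.
  move=> /andP[/eqP d'2 /eqP d'1]; have dE : d' = d.
    by apply: val_inj; rewrite [RHS]surjective_pairing d'2 d'1 -surjective_pairing.
  by move: Em; rewrite dE -md => /(can_inj mK).
exists F; split=> //.
- split=> [u v|u]; first by apply/idP/idP; apply: Fsym.
  by apply: contraFF (eI u) => /Fe.
- move=> u; have -> : nbr F u = [set nb u false; nb u true] by apply/setP => v; rewrite !inE.
  (* Equal neighbours would make one dart the partner of both copies of [u]. *)
  rewrite cards2; case: eqP => //= nbE.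
  have [d [md d1 d2]] := nbP u false; have [d' [md' d1' d2']] := nbP u true.
  have dE : d = d'.
    by apply: val_inj; rewrite [LHS]surjective_pairing [RHS]surjective_pairing d1 d2 d1' d2' nbE.
  by move: md; rewrite dE -md' => /(can_inj mK).
Qed.

Lemma card_darts (T : finType) (e : rel T) (A B : {set T}) :
  #|[set d : dart e | ((val d).1 \in A) && ((val d).2 \in B)]| = edges e A B.
Proof.
rewrite /edges pair_big -(card_imset _ val_inj) -sum1_card.
rewrite [RHS](eq_bigr (fun p => if e p.1 p.2 then 1 else 0)); last by move=> p _; case: (e _ _).
rewrite -big_mkcondr; apply: eq_bigl => p; apply/imsetP/andP => [[d]|[pAB ep]].
  by rewrite inE => dAB ->; split=> //; apply: (valP d).
by exists (Sub p ep); rewrite ?inE.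
Qed.

(** * From a tight barrier of the gadget to an obstruction *)

Section GadgetBarrier.
Variables (T : finType) (e : rel T).
Hypotheses (eS : symmetric e) (eI : irreflexive e) (e_deg : forall u, exists v, e u v).
Variables (W : {set (T * bool) + dart e}) (P : {set {set (T * bool) + dart e}}).
Hypotheses (bP : barrier (@gadget T e) W P)
  (tight : forall w A B, w \in W ->
      exists C x, [/\ C \in P, C != A, C != B, x \in C & gadget w x]).

Let trivP : trivIset P. Proof. by case: bP. Qed.

Let blockE C x : C \in P -> x \in C -> pblock P x = C. Proof. exact: def_pblock. Qed.

Let blockW C x : C \in P -> x \in C -> x \notin W.
Proof. by case: bP => _ oP _ /oP[_ dC _] xC; rewrite (disjointFr dC). Qed.

Let blockN C x y : C \in P -> x \in C -> gadget x y -> y \notin W -> y \in C.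
Proof. by case: bP => _ oP _ /oP[_ _ clC]; apply: clC. Qed.

(** The copies of [u] have the same neighbours. One in [W] touches two different pieces, and the
    other, if outside [W], would belong to both. *)
Let copyW u b b' : inl (u, b) \in W -> inl (u, b') \in W.
Proof.
move=> uW; have [C1 [x1 [C1P _ _ x1C1 gx1]]] := tight set0 set0 uW.
have [C2 [x2 [C2P C21 _ x2C2 gx2]]] := tight C1 C1 uW.
apply: contraT => ub'W; case/negP: C21; apply/eqP.
have gb' (x : T * bool + dart e) : gadget (inl (u, b)) x -> gadget x (inl (u, b')) by case: x.
rewrite -(blockE C1P (blockN C1P x1C1 (gb' _ gx1) ub'W)).
by rewrite (blockE C2P (blockN C2P x2C2 (gb' _ gx2) ub'W)).
Qed.

Let dart_nbr (d : dart e) x : gadget (inr d) x ->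
  [\/ x = inl ((val d).1, false), x = inl ((val d).1, true) | x = inr (rev_dart eS d)].
Proof.
case: x => [[u []] /= /eqP<-|d' /= /andP[/eqP d1 /eqP d2]]; [by apply: Or32 | by apply: Or31 |].
by apply: Or33; congr inr; apply: val_inj; rewrite [LHS]surjective_pairing /= d1 d2.
Qed.

(** A dart has just three neighbours, so those of a dart in [W] lie in three different pieces. *)
Let dartW (d : dart e) : inr d \in W ->
  [/\ forall b, inl ((val d).1, b) \in cover P,
      pblock P (inl ((val d).1, false)) != pblock P (inl ((val d).1, true)) &
      inr (rev_dart eS d) \notin W].
Proof.
move=> dW; set p := inl ((val d).1, false); set q := inl ((val d).1, true).
set r := inr (rev_dart eS d).
have coverP C x : C \in P -> x \in C -> x \in cover P by move=> CP xC; apply/bigcupP; exists C.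
have [C1 [x1 [C1P C1q C1r x1C1 /dart_nbr gx1]]] := tight (pblock P q) (pblock P r) dW.
have [C2 [x2 [C2P C2p C2r x2C2 /dart_nbr gx2]]] := tight (pblock P p) (pblock P r) dW.
have [C3 [x3 [C3P C3p C3q x3C3 /dart_nbr gx3]]] := tight (pblock P p) (pblock P q) dW.
have x1p : x1 = p.
  by case: gx1 => // xE; rewrite -(blockE C1P x1C1) xE eqxx in C1q C1r.
have x2q : x2 = q.
  by case: gx2 => // xE; rewrite -(blockE C2P x2C2) xE eqxx in C2p C2r.
have x3r : x3 = r.
  by case: gx3 => // xE; rewrite -(blockE C3P x3C3) xE eqxx in C3p C3q.
split.
- by case; rewrite -/p -/q -?x1p -?x2q; [apply: coverP x2C2 | apply: coverP x1C1].
- by rewrite -x1p (blockE C1P x1C1).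
- by rewrite -x3r (blockW C3P x3C3).
Qed.

Let S : {set T} := [set u | inl (u, false) \in W].
Let D : {set T} := [set u | [exists d : dart e, ((val d).1 == u) && (inr d \in W)]].

Let inlW u b : (inl (u, b) \in W) = (u \in S).
Proof. by rewrite inE; apply/idP/idP; apply: copyW. Qed.

Let inD u : u \in D -> exists2 d : dart e, (val d).1 = u & inr d \in W.
Proof. by rewrite inE => /existsP[d /andP[/eqP <- dW]]; exists d. Qed.

Let coverD u b : u \in D -> inl (u, b) \in cover P.
Proof. by case/inD => d <- /dartW[]. Qed.

(** A dart outside [W] with tail in [D] would put both copies of its tail into one piece, against
    [dartW]. *)
Let inrW (d : dart e) : (inr d \in W) = ((val d).1 \in D).
Proof.
apply/idP/idP => [dW|]; first by rewrite inE; apply/existsP; exists d; rewrite eqxx.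
case/inD => d' d'1 /dartW[]; rewrite d'1 => cov neq _; apply: contraNT neq => dW.
have bl b : pblock P (inl ((val d).1, b)) = pblock P (inr d).
  have BP : pblock P (inl ((val d).1, b)) \in P by rewrite pblock_mem.
  have cb : inl ((val d).1, b) \in pblock P (inl ((val d).1, b)) by rewrite mem_pblock.
  by rewrite [RHS](blockE BP) //; apply: (blockN BP cb) dW => /=.
by rewrite !bl.
Qed.

Let disjSD : [disjoint S & D].
Proof.
rewrite disjoint_sym disjoints_subset; apply/subsetP => u /(coverD false)/bigcupP[C CP uC].
by rewrite in_setC -(inlW u false) (blockW CP uC).
Qed.

Let cardW : 2 * #|S| + edges e D setT <= #|W|.
Proof.
pose W1 : {set (T * bool) + dart e} := [set inl x | x in setX S setT].
pose W2 : {set (T * bool) + dart e} :=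
  [set inr d | d in [set d : dart e | ((val d).1 \in D) && ((val d).2 \in [set: T])]].
have <- : #|W1| = 2 * #|S| by rewrite card_imset ?cardsX ?cardsT ?card_bool 1?mulnC //; apply: inl_inj.
have <- : #|W2| = edges e D setT by rewrite card_imset ?card_darts //; apply: inr_inj.
have dW : [disjoint W1 & W2].
  by rewrite disjoints_subset; apply/subsetP => _ /imsetP[x _ ->]; rewrite inE; apply/imsetP => -[].
have := cardsUI W1 W2; rewrite (disjoint_setI0 dW) cards0 addn0 => <-.
apply: subset_leq_card; rewrite subUset; apply/andP; split; apply/subsetP => _ /imsetP[x + ->].
  by case: x => u b; rewrite in_setX inlW => /andP[].
by rewrite inE inrW => /andP[].
Qed.

(** The pieces through copies of vertices of [D] and those through darts from [S] to [D] are set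
    aside, at a cost of at most [2|D|] and [e(D, S)]; the remaining pieces project to odd pieces of
    the graph. *)
Let copyBlocks := [set pblock P (inl x) | x in setX D [set: bool]].
Let dartBlocks :=
  [set pblock P (inr d) | d in [set d : dart e | ((val d).1 \in S) && ((val d).2 \in D)]].
Let mainBlocks := P :\: (copyBlocks :|: dartBlocks).
Let proj (C : {set (T * bool) + dart e}) : {set T} := [set u | inl (u, false) \in C].

Let cardP : #|P| <= #|mainBlocks| + 2 * #|D| + edges e D S.
Proof.
have lec : #|copyBlocks| <= 2 * #|D|.
  by rewrite (leq_trans (leq_imset_card _ _)) // cardsX cardsT card_bool mulnC.
have led : #|dartBlocks| <= edges e D S.
  by rewrite (leq_trans (leq_imset_card _ _)) // card_darts edges_sym.
rewrite -addnA; apply: leq_trans (leq_add (leqnn _) (leq_add lec led)).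
apply: leq_trans (leq_add (leqnn _) (leq_card_setU copyBlocks dartBlocks)).
rewrite addnC -(cardsID (copyBlocks :|: dartBlocks) P) leq_add2r.
by apply: subset_leq_card; apply: subsetIr.
Qed.

Let mainP C : C \in mainBlocks ->
  [/\ C \in P, forall u b, inl (u, b) \in C -> (u \notin S) && (u \notin D) &
    forall d, inr d \in C -> ((val d).1 \notin D) && ~~ (((val d).1 \in S) && ((val d).2 \in D))].
Proof.
rewrite in_setD in_setU negb_or => /andP[/andP[Cc Cd] CP]; split=> // [u b uC|d dC].
  rewrite -(inlW u b) (blockW CP uC) /=; apply: contra Cc => uD.
  by apply/imsetP; exists (u, b); rewrite ?in_setX ?uD ?inE // (blockE CP uC).
rewrite -inrW (blockW CP dC) /=; apply: contra Cd => dSD.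
by apply/imsetP; exists d; [rewrite inE | rewrite (blockE CP dC)].
Qed.

Let main_dart C (d : dart e) b : C \in mainBlocks -> inl ((val d).1, b) \in C -> inr d \in C.
Proof.
move=> /mainP[CP uC _] dC; apply: (blockN CP dC) => /=; first by rewrite eqxx.
by rewrite inrW; case/andP: (uC _ _ dC).
Qed.

Let main_copy C (d : dart e) b :
  C \in mainBlocks -> inr d \in C -> (val d).1 \notin S -> inl ((val d).1, b) \in C.
Proof.
by move=> /mainP[CP _ _] dC dS; apply: (blockN CP dC) => /=; rewrite ?eqxx // inlW.
Qed.

(** A dart leaving [u], supplied by [e_deg], is adjacent to both copies and carries membership in
    [C] from one to the other. *)
Let in_proj C u b : C \in mainBlocks -> (inl (u, b) \in C) = (u \in proj C).
Proof.
move=> CM; rewrite inE; have [v uv] := e_deg u; pose d : dart e := Sub (u, v) uv.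
have [_ uC _] := mainP CM.
suff cp b1 b2 : inl (u, b1) \in C -> inl (u, b2) \in C by apply/idP/idP; apply: cp.
move=> u1; apply: (main_copy (d := d) b2 CM); first exact: (main_dart (b := b1) CM).
by case/andP: (uC _ _ u1).
Qed.

(** The darts from [proj C] to [D] form [X]. Swapping copies and reversing darts pairs off the rest
    of [C], so [X] is odd like [C]. *)
Let odd_proj C : C \in mainBlocks -> odd (edges e D (proj C)).
Proof.
move=> CM; have [CP uC dC] := mainP CM; have [_ oP _] := bP; have [oC _ _] := oP C CP.
rewrite edges_sym // -card_darts -(card_imset _ (@inr_inj (T * bool) _)).
set X := [set inr _ | _ in _].
have XC : X \subset C.
  apply/subsetP => _ /imsetP[d + ->]; rewrite inE => /andP[d1 _].
  by apply: (main_dart (b := false) CM); rewrite in_proj.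
have XE (d : dart e) : (inr d \in X) = ((val d).1 \in proj C) && ((val d).2 \in D).
  by rewrite mem_imset ?inE //; apply: inr_inj.
suff evCX : ~~ odd #|C :\: X|.
  by move: oC; rewrite -(cardsID X C) (setIidPr XC) oddD (negbTE evCX) addbF.
apply: (fpf_involution_even (f := fun x : (T * bool) + dart e =>
  match x with inl u => inl (u.1, ~~ u.2) | inr d => inr (rev_dart eS d) end)).
have inlX x : inl x \notin X by apply/imsetP => -[].
case=> [[u b]|d] /=; rewrite in_setD => /andP[xX xC]; split=> //.
- by rewrite in_setD inlX /= in_proj // -(in_proj u b).
- by rewrite negbK.
- by apply/eqP => -[]; case: (b).
- have /andP[d1 d2] := dC d xC.
  have d2D : (val d).2 \notin D.
    apply: contra xX => d2D; rewrite XE d2D andbT -(in_proj _ false CM) main_copy //.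
    by move: d2; rewrite d2D andbT.
  rewrite in_setD XE /= (negbTE d1) andbF /=.
  by apply: (blockN CP xC); rewrite ?inrW //= !eqxx.
- by rewrite rev_dartK.
- by rewrite (inj_eq (@inr_inj _ _)) rev_dart_neq.
Qed.

Lemma tight_barrier_obstruction : exists S D Q, obstruction e S D Q.
Proof.
have proj_inj : {in mainBlocks &, injective proj}.
  move=> C C' CM C'M eqC; have [CP _ _] := mainP CM; have [C'P _ _] := mainP C'M.
  have [C0|[u uC]] := set_0Vmem (proj C).
    by have := odd_proj CM; rewrite C0 /edges exchange_big big_set0.
  rewrite -(blockE CP (x := inl (u, false))) ?in_proj //.
  by rewrite (blockE C'P) // in_proj // -eqC.
exists S, D, [set proj C | C in mainBlocks]; split=> //.
- apply/trivIsetP => _ _ /imsetP[C CM ->] /imsetP[C' C'M ->] CC'.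
  rewrite disjoints_subset; apply/subsetP => u uC; rewrite in_setC; apply: contra CC' => uC'.
  have [CP _ _] := mainP CM; have [C'P _ _] := mainP C'M.
  rewrite -(blockE CP (x := inl (u, false))) ?in_proj //.
  by rewrite (blockE C'P) // in_proj.
- move=> _ /imsetP[C CM ->]; split; last 1 first.
  + move=> u v uC uv; rewrite in_setU negb_or => /andP[vS vD].
    pose d : dart e := Sub (u, v) uv; have [CP _ _] := mainP CM.
    have dC : inr d \in C by apply: (main_dart (b := false) CM); rewrite in_proj.
    rewrite -(in_proj v false) //; apply: (main_copy (d := rev_dart eS d)) => //.
    by apply: (blockN CP dC); rewrite ?inrW //= !eqxx.
  + rewrite disjoints_subset; apply/subsetP => u; rewrite -(in_proj u false) //.
    by have [_ uC _] := mainP CM => /uC; rewrite in_setC in_setU negb_or.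
  + exact: odd_proj.
(* Splitting [edges e D setT] at [S], the term [edges e D S] cancels between the bounds on [W] and
   on [P]. *)
- have [_ _ ltWP] := bP; have := cardW; have := cardP;
  rewrite (edges_setID e D setT S) setTI setTD card_in_imset //.
  by move: ltWP; move: #|P| #|W| #|mainBlocks| => p w m; lia.
Qed.

End GadgetBarrier.

(** The hard direction of Tutte's 2-factor condition, obtained from the 1-factor theorem on the
    gadget. *)
Lemma two_factor_or_obstruction (T : finType) (e : rel T) :
  simple_graph e -> (forall u, exists v, e u v) ->
  (exists f, two_factor e f) \/ exists S D P, obstruction e S D P.
Proof.
move=> [eS eI] e_deg; have gS := @gadget_sym T e.
have evV := gadget_even eS eI.
have [m|[W [P bP]]] := tutte gS (gadget_irr eI) evV; first by left; apply: gadget_matching m.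
have [W' [P' [bP' tight]]] := tight_barrier gS evV bP.
by right; exact: tight_barrier_obstruction tight.
Qed.

(** * Reducing an obstruction *)

Lemma disjoint_setU1 (V : finType) (x : V) (A B : {set V}) :
  [disjoint x |: A & B] = (x \notin B) && [disjoint A & B].
Proof. by rewrite -!setI_eq0 setIUl setU_eq0 setI_eq0 disjoints1. Qed.

Lemma card_nbrI (T : finType) (e : rel T) (A : {set T}) x :
  #|nbr e x :&: A| = \sum_(y in A) e x y.
Proof.
rewrite -sum1_card (eq_bigl (fun y => (y \in A) && e x y)).
  by rewrite big_mkcondr; apply: eq_bigr => y _; case: (e x y).
by move=> y; rewrite !inE andbC.
Qed.

Lemma edgesE (T : finType) (e : rel T) (A B : {set T}) :
  edges e A B = \sum_(x in A) #|nbr e x :&: B|.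
Proof. by apply: eq_bigr => x _; rewrite card_nbrI. Qed.

Lemma edgesD1l (T : finType) (e : rel T) (A B : {set T}) x :
  x \in A -> edges e A B = #|nbr e x :&: B| + edges e (A :\ x) B.
Proof. by move=> xA; rewrite !edgesE (big_setD1 x). Qed.

Lemma edgesD1r (T : finType) (e : rel T) (A B : {set T}) x :
  symmetric e -> x \in B -> edges e A B = #|nbr e x :&: A| + edges e A (B :\ x).
Proof. by move=> eS xB; rewrite ![edges e A _]edges_sym // (edgesD1l _ _ xB). Qed.

Lemma odd_piece_neq0 (T : finType) (e : rel T) (S D C : {set T}) :
  odd_piece e S D C -> C != set0.
Proof. by case=> _ + _; apply: contraTneq => ->; rewrite /edges exchange_big big_set0. Qed.

Lemma obstruction_add (T : finType) (e : rel T) (S D C : {set T}) (Q : {set {set T}}) :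
  [disjoint S & D] -> trivIset Q -> (forall B, B \in Q -> odd_piece e S D B) ->
  odd_piece e S D C -> (forall B, B \in Q -> [disjoint C & B]) ->
  2 * #|S| + edges e D (~: S) < 2 * #|D| + #|Q|.+1 -> obstruction e S D (C |: Q).
Proof.
move=> dSD tQ oQ oC dC ltQ; have CQ : C \notin Q.
  by apply: contra (odd_piece_neq0 oC) => /dC; rewrite -setI_eq0 setIid.
split; [by [] | | | by rewrite cardsU1 CQ].
  apply/trivIsetP => A B; rewrite !in_setU1 => /predU1P[->|AQ] /predU1P[->|BQ].
  - by rewrite eqxx.
  - by move=> _; apply: dC.
  - by move=> _; rewrite disjoint_sym dC.
  - by move=> AB; apply: (trivIsetP tQ).
by move=> B; rewrite in_setU1 => /predU1P[->|/oQ].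
Qed.

(** Moving [c] into [S] raises [2|S|] by 2 and lowers the edge count by [k], which is at least 2. If
    [k] is even, the rest of [C] is still an odd piece; if [k] is odd, it is at least 3 and [C] can
    be given up. *)
Lemma obstruction_move_piece (T : finType) (e : rel T) (S D C : {set T}) P c :
  symmetric e -> obstruction e S D P -> C \in P -> c \in C -> 1 < #|nbr e c :&: D| ->
  exists P', obstruction e (c |: S) D P'.
Proof.
move=> eS [dSD tP oP ltP] CP cC; set k := #|nbr e c :&: D| => k1.
have [dC oC clC] := oP C CP.
have /norP[cS cD] : ~~ ((c \in S) || (c \in D)) by rewrite -in_setU (disjointFr dC).
have SE : (~: S) :\ c = ~: (c |: S) by apply/setP => x; rewrite !inE negb_or.
have EP : edges e D (~: S) = k + edges e D (~: (c |: S)).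
  by rewrite (edgesD1r D (x := c)) // ?SE // inE.
have EC : edges e D C = k + edges e D (C :\ c) by rewrite (edgesD1r D (x := c)).
have cS' : #|c |: S| = #|S|.+1 by rewrite cardsU1 cS.
have cP : #|P| = #|P :\ C|.+1 by rewrite (cardsD1 C) CP.
have dS'D : [disjoint c |: S & D].
  by rewrite disjoint_setU1 cD.
have tQ : trivIset (P :\ C) by apply: trivIsetS tP; apply: subsetDl.
have dQ B : B \in P :\ C -> [disjoint C & B].
  by rewrite in_setD1 => /andP[BC BP]; apply: (trivIsetP tP) => //; rewrite eq_sym.
have oQ B : B \in P :\ C -> odd_piece e (c |: S) D B.
  move=> BQ; have dCB := dQ B BQ; move: BQ; rewrite in_setD1 => /andP[BC BP].
  have [dB oB clB] := oP B BP; split=> //.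
    rewrite -setUA disjoint_sym disjoint_setU1 (disjointFr dCB cC) /=; by rewrite disjoint_sym.
  move=> x y xB xy; rewrite -setUA in_setU1 negb_or => /andP[_]; exact: (clB x).
have [oddk|evk] := boolP (odd k).
  exists (P :\ C); split=> //; rewrite cS'.
  have k2 : k != 2 by apply: contraTneq oddk => ->.
  by move: k1 k2 ltP; rewrite EP cP; clear; lia.
exists ((C :\ c) |: (P :\ C)); apply: obstruction_add => //.
- split.
  + rewrite -setUA disjoint_sym disjoint_setU1 !inE eqxx /= disjoint_sym.
    by apply: disjointWl dC; apply: subsetDl.
  + by move: oC; rewrite EC oddD (negbTE evk).
  + move=> x y; rewrite in_setD1 => /andP[_ xC] xy.
    rewrite -setUA in_setU1 negb_or in_setD1 => /andP[-> yN] /=; exact: (clC x).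
- by move=> B /dQ; apply: disjointWl; apply: subsetDl.
- by rewrite cS'; move: k1 ltP; rewrite EP cP; clear; lia.
Qed.

(** Dropping [t] lowers [2|D|] by 2 and the edge count by the degree of [t]. If that degree is even,
    [t] joins [C] without changing the parity of its edge count; if odd, it is at least 3 and [C]
    can be given up. *)
Lemma obstruction_drop_target (T : finType) (e : rel T) (S D C : {set T}) P t :
  symmetric e -> irreflexive e -> 1 < #|nbr e t| ->
  obstruction e S D P -> C \in P -> t \in D -> nbr e t \subset C :|: D ->
  exists P', obstruction e S (D :\ t) P'.
Proof.
move=> eS eI d1 [dSD tP oP ltP] CP tD nt; have [dC oC clC] := oP C CP.
have tS : t \notin S by rewrite (disjointFl dSD).
have tC : t \notin C.
  by apply: contraTN tD => /(disjointFr dC); rewrite in_setU => /negbT/norP[].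
have dCS : [disjoint C & S] by apply: disjointWr dC; apply: subsetUl.
have dCD : [disjoint C & D] by apply: disjointWr dC; apply: subsetUr.
have ntS : nbr e t :&: ~: S = nbr e t.
  apply/setIidPl; apply: subset_trans nt _; rewrite subUset -!disjoints_subset dCS.
  by rewrite disjoint_sym.
have EP : edges e D (~: S) = #|nbr e t| + edges e (D :\ t) (~: S).
  by rewrite (edgesD1l _ _ tD) ntS.
have cD : #|D| = #|D :\ t|.+1 by rewrite (cardsD1 t) tD.
have cP : #|P| = #|P :\ C|.+1 by rewrite (cardsD1 C) CP.
have tQ : trivIset (P :\ C) by apply: trivIsetS tP; apply: subsetDl.
have dQ B : B \in P :\ C -> [disjoint C & B].
  by rewrite in_setD1 => /andP[BC BP]; apply: (trivIsetP tP) => //; rewrite eq_sym.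
have dSD' : [disjoint S & D :\ t] by apply: disjointWr dSD; apply: subsetDl.
have oQ B : B \in P :\ C -> odd_piece e S (D :\ t) B.
  move=> BQ; have dCB := dQ B BQ; move: BQ; rewrite in_setD1 => /andP[BC BP].
  have [dB oB clB] := oP B BP.
  have tB x : x \in B -> ~~ e x t.
    move=> xB; apply: contraFN (disjointFr dB xB) => xt; have := subsetP nt x.
    by rewrite !inE eS xt (disjointFl dCB xB) => /(_ isT) /= ->; rewrite orbT.
  split.
  - by apply: disjointWr dB; apply: setUS; apply: subsetDl.
  - move: oB; rewrite (edgesD1l _ _ tD) oddD; suff -> : nbr e t :&: B = set0 by rewrite cards0.
    apply/setP => x; rewrite !inE; apply/negbTE/andP => -[tx /tB]; by rewrite eS tx.
  - move=> x y xB xy yN; apply: (clB x) => //; move: yN; rewrite !inE.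
    by have [yt|//] := eqVneq y t; have := tB x xB; rewrite -yt xy.
have cI : #|nbr e t| = #|nbr e t :&: C| + #|nbr e t :&: (D :\ t)|.
  rewrite -(cardsID C) //; congr (_ + _); apply: eq_card => x; rewrite !inE.
  have := subsetP nt x; rewrite !inE; have [->|_] := eqVneq x t; first by rewrite eI !andbF.
  have [tx /(_ isT)|] := boolP (e t x); rewrite ?andbF ?andbT //=.
  by have [xC|_ /= ->] := boolP (x \in C); first by rewrite (disjointFr dCD xC).
have EC : edges e D C = #|nbr e t :&: C| + edges e (D :\ t) C by rewrite (edgesD1l _ _ tD).
have EC' : edges e (D :\ t) (t |: C) = #|nbr e t :&: (D :\ t)| + edges e (D :\ t) C.
  by rewrite (edgesD1r _ (x := t)) ?setU1K // setU11.
have [oddk|evk] := boolP (odd #|nbr e t|).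
  exists (P :\ C); split=> //.
  have k2 : #|nbr e t| != 2 by apply: contraTneq oddk => ->.
  by move: d1 k2 ltP; rewrite EP cP cD; clear; lia.
exists ((t |: C) |: (P :\ C)); apply: obstruction_add => //.
- split.
  + rewrite disjoint_setU1 !inE eqxx orbF tS /=.
    by apply: disjointWr dC; apply: setUS; apply: subsetDl.
  + move: evk oC; rewrite EC EC' cI !oddD.
    by case: (odd _); case: (odd _); case: (odd _).
  + move=> x y; rewrite in_setU1 => xC xy; rewrite !inE.
    have [//|yt] := eqVneq y t; rewrite /= => yN.
    case/predU1P: xC => [xt|xC]; last by apply: (clC x) => //; rewrite inE.
    have := subsetP nt y; rewrite !inE -xt xy => /(_ isT) /orP[//|yD].
    by rewrite yD orbT in yN.
- move=> B BQ; have := dQ B BQ => dCB; rewrite disjoint_setU1 dCB andbT.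
  move: BQ; rewrite in_setD1 => /andP[_ /oP[dB _ _]]; apply: contraTN tD => /(disjointFr dB).
  by rewrite in_setU => /negbT/norP[].
- by move: d1 ltP; rewrite EP cP cD; clear; lia.
Qed.

(** Both reductions decrease [#|D| + #|~: S|]; the two further properties say that neither applies
    any more. *)
Lemma tight_obstruction (T : finType) (e : rel T) S D P :
  symmetric e -> irreflexive e -> (forall x, 1 < #|nbr e x|) -> obstruction e S D P ->
  exists S' D' P', [/\ obstruction e S' D' P',
    forall C c, C \in P' -> c \in C -> #|nbr e c :&: D'| <= 1 &
    forall C t, C \in P' -> t \in D' -> exists y, [/\ e t y, y \notin C & y \notin D']].
Proof.
move=> eS eI deg; have [n] := ubnP (#|D| + #|~: S|).
elim: n S D P => // n IHn S D P ltn oP; have [dSD _ pP _] := oP.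
have [/existsP[C /existsP[c /and3P[CP cC lt1]]]|noC] := boolP
  [exists C : {set T}, exists c, [&& C \in P, c \in C & 1 < #|nbr e c :&: D|]].
  have [P' oP'] := obstruction_move_piece eS oP CP cC lt1.
  apply: IHn oP'; have [dC _ _] := pP C CP.
  have cS : c \notin S by have := disjointFr dC cC; rewrite in_setU => /negbT/norP[].
  move: ltn (cardsC S) (cardsC (c |: S)); rewrite cardsU1 cS.
  by clear; lia.
have [/existsP[C /existsP[t /and3P[CP tD nt]]]|noD] := boolP
  [exists C : {set T}, exists t, [&& C \in P, t \in D & nbr e t \subset C :|: D]].
  have [P' oP'] := obstruction_drop_target eS eI (deg t) oP CP tD nt.
  by apply: IHn oP'; move: ltn; rewrite (cardsD1 t) tD; clear; lia.
exists S, D, P; split=> // [C c CP cC|C t CP tD].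
  rewrite leqNgt; apply: contra noC => lt1.
  by apply/existsP; exists C; apply/existsP; exists c; rewrite CP cC.
have : ~~ (nbr e t \subset C :|: D).
  by apply: contra noD => nt; apply/existsP; exists C; apply/existsP; exists t; rewrite CP tD.
by case/subsetPn => y; rewrite !inE negb_or => ty /andP[]; exists y.
Qed.

(** * s-quadrangular graphs *)

(** The two vertices form a q-set by themselves. *)
Lemma quadrangular_pair (T : finType) (e : rel T) x y :
  s_quadrangular e -> x != y -> nbr e x :&: nbr e y != set0 ->
  1 < #|nbr e x :&: nbr e y|.
Proof.
move=> quad xy xy0; have qxy : qset e [set x; y].
  split=> [|u]; first by rewrite cards2 xy.
  rewrite !inE => /orP[]/eqP->; [exists y|exists x]; rewrite !inE eqxx ?orbT //.
    by rewrite eq_sym xy.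
  by rewrite xy setIC.
have := quad _ qxy; rewrite cards2 xy => /leq_trans; apply; apply: subset_leq_card.
apply/bigcupsP => u; rewrite !inE => uxy; apply/bigcupsP => v; rewrite !inE => /andP[vxy uv].
case/orP: uxy vxy uv => [] /eqP-> /orP[] /eqP->; rewrite ?eqxx // => _.
by rewrite setIC.
Qed.

(** If [x] had at most one neighbour, a vertex at distance two would share exactly one neighbour
    with it. So [x] and its neighbours would be closed under adjacency and form the whole graph,
    with at most two vertices. *)
Lemma quadrangular_degree (T : finType) (e : rel T) :
  symmetric e -> connected_graph e -> 2 < #|T| -> s_quadrangular e ->
  forall x, 1 < #|nbr e x|.
Proof.
move=> eS conn cT quad x; rewrite ltnNge; apply/negP => degx; pose A := x |: nbr e x.
have [/existsP[p /existsP[q /and3P[pA qA pq]]]|none] := boolP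
  [exists p, exists q, [&& p \in A, q \notin A & e p q]].
  move: qA; rewrite in_setU1 negb_or inE => /andP[qx xq].
  move: pA; rewrite in_setU1 inE => /predU1P[pE|xp]; first by rewrite -pE pq in xq.
  have xq' : x != q by rewrite eq_sym.
  have := quadrangular_pair quad xq'; suff -> : nbr e x :&: nbr e q != set0.
    move=> /(_ isT); rewrite ltnNge => /negP; apply.
    by apply: leq_trans degx; apply: subset_leq_card; apply: subsetIl.
  by apply/set0Pn; exists p; rewrite !inE xp eS.
have clA : closed e (mem A).
  apply: intro_closed => [|p q pq pA]; first exact: sym_connect_sym.
  apply: contraNT none => qA.
  by apply/existsP; exists p; apply/existsP; exists q; rewrite pA qA.
have AT : A = setT.
  apply/setP => y; rewrite in_setT; have xyA : (x \in A) = (y \in A) := closed_connect clA (conn x y).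
  by rewrite -xyA setU11.
move: cT; rewrite -cardsT -AT cardsU1; by move: degx; case: (x \notin _); clear => /=; lia.
Qed.

(** If nonempty, [Z'] is a q-set whose common neighbours lie in [M], so [|Z'| <= |M|]. Each other
    vertex of [Z] has a neighbour in [S :\: M], and no vertex there serves two of them. Adding up
    gives [|M| + |S :\: M|], which is [|S| + |M :\: S|]. *)
Lemma quadrangular_count (T : finType) (e : rel T) (Z S : {set T}) :
  symmetric e -> s_quadrangular e -> (forall z, z \in Z -> exists2 s, s \in S & e z s) ->
  #|Z| <= #|S| + #|[set v in ~: S | 1 < #|nbr e v :&: Z|]|.
Proof.
move=> eS quad ZS; pose M := [set v | 1 < #|nbr e v :&: Z|].
pose Z' := [set z in Z | nbr e z :&: M != set0].
have MP u w v : u \in Z -> w \in Z -> u != w -> e u v -> e w v -> v \in M.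
  move=> uZ wZ uw uv wv; rewrite inE (cardsD1 u) (cardsD1 w) !inE uZ wZ.
  by rewrite (eS v u) (eS v w) uv wv eq_sym uw.
have leM : #|Z'| <= #|M|.
  have [->|[u uZ']] := set_0Vmem Z'; first by rewrite cards0.
  have part z : z \in Z' -> exists w, [/\ w \in Z', w != z & nbr e z :&: nbr e w != set0].
    rewrite inE => /andP[zZ /set0Pn[v]]; rewrite !inE => /andP[zv vM].
    move: (vM); rewrite (cardsD1 z) !inE zZ eS zv /= add1n ltnS.
    case/card_gt0P=> w; rewrite !inE => /andP[wz /andP[vw wZ]].
    have wv : e w v by rewrite eS.
    exists w; split=> //; last by apply/set0Pn; exists v; rewrite !inE zv wv.
    by rewrite inE wZ; apply/set0Pn; exists v; rewrite !inE wv.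
  have qZ' : qset e Z'.
    split=> //; have [w [wZ' wu _]] := part u uZ'.
    by rewrite (cardsD1 u) uZ' (cardsD1 w) in_setD1 wu wZ'.
  apply: leq_trans (quad _ qZ') _; apply: subset_leq_card.
  apply/bigcupsP => z; rewrite inE => /andP[zZ _]; apply/bigcupsP => w /andP[].
  rewrite inE => /andP[wZ _] zw; apply/subsetP => v; rewrite !inE => /andP[zv wv].
  by have := MP z w v zZ wZ zw zv wv; rewrite inE.
have leS : #|Z :\: Z'| <= #|S :\: M|.
  apply: (@leq_trans (edges e (Z :\: Z') (S :\: M))).
    rewrite edgesE -sum1_card; apply: leq_sum => z.
    rewrite !inE negb_and negbK => /andP[+ zZ]; rewrite zZ /= => /eqP zM.
    have [s sS zs] := ZS z zZ; apply/card_gt0P; exists s; rewrite in_setI in_setD sS andbT.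
    by have := in_set0 s; rewrite -zM in_setI inE zs /= => ->.
  rewrite edges_sym // edgesE -sum1_card; apply: leq_sum => s.
  rewrite in_setD inE -leqNgt => /andP[+ _]; apply: leq_trans; apply: subset_leq_card.
  by apply: setIS; apply: subsetDl.
have <- : M :\: S = [set v in ~: S | 1 < #|nbr e v :&: Z|] by apply/setP => v; rewrite !inE.
have ZZ : Z :&: Z' = Z' by apply/setIidPr/subsetP => z; rewrite inE => /andP[].
have := cardsID Z' Z; rewrite ZZ; have := cardsID M S; have := cardsID S M.
by move: leM leS; rewrite (setIC M S); clear; lia.
Qed.

(** * Counting in a tight obstruction *)

Lemma sum_subset (T : finType) (A B : {set T}) (F : T -> nat) :
  A \subset B -> \sum_(v in A) F v = \sum_(v in B) (v \in A) * F v.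
Proof.
move=> /setIidPr AB; rewrite -{1}AB (eq_bigl (fun v => (v \in B) && (v \in A))).
  by rewrite big_mkcondr; apply: eq_bigr => v _; case: (v \in A); rewrite ?mul1n.
by move=> v; rewrite inE.
Qed.

(* [x] and [y] have the common neighbour [t], hence a second one, which can only
   lie in [S]. *)
Lemma tight_obstruction_attached (T : finType) (e : rel T) (S D C : {set T}) P x t :
  symmetric e -> s_quadrangular e -> obstruction e S D P ->
  C \in P -> x \in C -> e x t -> t \in D -> [disjoint nbr e t & S] ->
  #|nbr e x :&: D| <= 1 -> (exists y, [/\ e t y, y \notin C & y \notin D]) ->
  exists2 s, s \in S & e x s.
Proof.
move=> eS quad [_ _ oP _] CP xC xt tD tS degx [y [ty yC yD]].
have [_ _ clC] := oP C CP.
have yS : y \notin S by rewrite (disjointFr tS) // inE.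
have xy : x != y by apply: contraNneq yC => <-.
have tI : t \in nbr e x :&: nbr e y by rewrite !inE xt eS.
have := quadrangular_pair quad xy; suff -> : nbr e x :&: nbr e y != set0; last first.
  by apply/set0Pn; exists t.
move=> /(_ isT); rewrite (cardsD1 t) tI ltnS => /card_gt0P[z].
rewrite !inE => /andP[zt /andP[xz yz]].
exists z => //; apply/negPn/negP => zS.
have zD : z \notin D.
  apply/negP => zD; move: degx; rewrite (cardsD1 t) (cardsD1 z) !inE zt xt xz zD tD.
  by [].
have zC : z \in C by apply: (clC x) => //; rewrite in_setU negb_or zS.
by case/negP: yC; apply: (clC z) => //; rewrite ?in_setU ?negb_or ?yS // eS.
Qed.

Lemma no_tight_obstruction (T : finType) (e : rel T) (S D : {set T}) P :
  symmetric e -> 0 < #|T| -> (forall x, 1 < #|nbr e x|) -> s_quadrangular e ->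
  obstruction e S D P ->
  (forall C c, C \in P -> c \in C -> #|nbr e c :&: D| <= 1) ->
  (forall C t, C \in P -> t \in D -> exists y, [/\ e t y, y \notin C & y \notin D]) ->
  False.
Proof.
move=> eS /card_gt0P[x0 _] deg quad oSDP deg1 leave; have [dSD tP oP ltP] := oSDP.
pose L := [set t in D | [disjoint nbr e t & S]]; pose D0 := D :\: L.
pose P1 := [set C in P | edges e D0 C == 0]; pose P2 := P :\: P1.
have LD : L \subset D by apply/subsetP => t; rewrite inE => /andP[].
have D0D : D0 \subset D by apply: subsetDl.
have P1P C : C \in P1 -> C \in P by rewrite inE => /andP[].
have P2P C : C \in P2 -> C \in P by rewrite inE => /andP[].
have P1N C c : C \in P1 -> c \in C -> nbr e c :&: D0 = set0.
  rewrite inE edges_sym // => /andP[_ +] cC; rewrite (edgesD1l _ _ cC) addn_eq0.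
  by rewrite cards_eq0 => /andP[/eqP].
have closedP C c v : C \in P -> c \in C -> e c v -> v \notin S -> v \notin D -> v \in C.
  by move=> /oP[_ _ clC] cC cv vS vD; apply: (clC c) => //; rewrite in_setU negb_or vS.
have notSD C c : C \in P -> c \in C -> (c \notin S) && (c \notin D).
  by move=> /oP[dC _ _] /(disjointFr dC); rewrite in_setU => /negbT; rewrite negb_or.
have sameP C C' c : C \in P -> C' \in P -> c \in C -> c \in C' -> C = C'.
  by move=> CP C'P cC cC'; rewrite -(def_pblock tP CP cC) (def_pblock tP C'P cC').
(* An odd number of edges to [D] is nonzero, so each piece has a representative [a C] adjacent to
   [D]; [x0] is a default for sets outside [P]. *)
have /fin_all_exists[a aP] C : exists c, C \in P -> c \in C /\ exists2 t, t \in D & e c t.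
  have [CP|] := boolP (C \in P); last by exists x0.
  have [_ oC _] := oP C CP.
  have [/existsP[c /andP[cC /set0Pn[t]]]|none] :=
      boolP [exists c, (c \in C) && (nbr e c :&: D != set0)].
    by rewrite !inE => /andP[ct tD]; exists c => _; split=> //; exists t.
  move: oC; rewrite edges_sym // edgesE big1 // => c cC; apply/eqP.
  rewrite cards_eq0; apply: contraNT none => cD.
  by apply/existsP; exists c; rewrite cC.
pose X := [set a C | C in P1].
have cX : #|X| = #|P1|.
  apply: card_in_imset => C C' CP1 C'P1 eqa.
  have [aC _] := aP C (P1P C CP1); have [aC' _] := aP C' (P1P C' C'P1).
  by apply: (sameP C C' (a C)); rewrite ?P1P // eqa.
have dX : [disjoint D0 & X].
  rewrite disjoint_sym disjoints_subset; apply/subsetP => _ /imsetP[C CP1 ->].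
  have [aC _] := aP C (P1P C CP1); have /andP[_ aD] := notSD C (a C) (P1P C CP1) aC.
  by rewrite in_setC; apply: contra aD; apply: (subsetP D0D).
pose Z := D0 :|: X.
have cZ : #|Z| = #|D0| + #|P1| by rewrite cardsU (disjoint_setI0 dX) cards0 subn0 cX.
(* For [D0] this is the definition of [L]. A representative of a piece in [P1] has its neighbour in
   [D] inside [L], as required by [tight_obstruction_attached]. *)
have ZS z : z \in Z -> exists2 s, s \in S & e z s.
  rewrite in_setU => /orP[|/imsetP[C CP1 ->]].
    rewrite !inE => /andP[+ zD]; rewrite zD /= -setI_eq0 => /set0Pn[s].
    by rewrite !inE => /andP[zs sS]; exists s.
  have CP := P1P C CP1; have [aC [t tD at_]] := aP C CP.
  have tL : t \in L.
    apply/negPn/negP => tL; have := in_set0 t; rewrite -(P1N C (a C) CP1 aC).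
    by rewrite !(in_setI, in_setD) tL tD inE at_.
  apply: (tight_obstruction_attached eS quad oSDP CP aC at_ tD _ _ (leave C t CP tD)).
    by move: tL; rewrite inE => /andP[].
  exact: deg1 CP aC.
pose B := [set v in ~: S | 1 < #|nbr e v :&: Z|].
have leZ : #|Z| <= #|S| + #|B| by apply: quadrangular_count.
(* A neighbour in [X] of a vertex of [C] avoids [S] and [D], so it lies in [C] and can only be
   [a C]. *)
have XC C c : C \in P -> c \in C -> nbr e c :&: X \subset [set x | (x == a C) && (C \in P1)].
  move=> CP cC; apply/subsetP => x; rewrite in_setI [x \in nbr _ _]inE => /andP[cx /imsetP[C' C'P1 xE]].
  have [aC' _] := aP C' (P1P C' C'P1); have /andP[aS aD] := notSD C' _ (P1P C' C'P1) aC'.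
  have xC : x \in C by apply: (closedP C c) => //; rewrite xE.
  have CC' : C = C' by apply: (sameP C C' x CP (P1P C' C'P1) xC); rewrite xE.
  by rewrite inE xE CC' eqxx.
(* A vertex of a piece in [P1] can see only [a C] in [Z]; one of another piece sees no vertex of [X]
   and at most one of [D]. *)
have notB C v : C \in P -> v \in C -> v \notin B.
  move=> CP vC; apply/negP; rewrite inE => /andP[_]; apply/negP; rewrite -leqNgt.
  rewrite setIUr; have := XC C v CP vC; have [CP1|CP1] := boolP (C \in P1).
    rewrite (P1N C v CP1 vC) set0U => /subset_leq_card le1; apply: leq_trans le1 _.
    by rewrite -(cards1 (a C)); apply: subset_leq_card; apply/subsetP => x; rewrite !inE andbT.
  move=> /subset_leq_card; rewrite (_ : [set _ | _] = set0); last by apply/setP => x; rewrite !inE andbF.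
  rewrite cards0 leqn0 cards_eq0 => /eqP->; rewrite setU0.
  by apply: leq_trans (deg1 C v CP vC); apply: subset_leq_card; apply: setIS.
pose K := cover P2; pose Y := ~: S :\: K.
have KP v : v \in K -> exists2 C, C \in P2 & v \in C by move=> /bigcupP[C]; exists C.
have BY : B \subset Y.
  apply/subsetP => v vB; rewrite in_setD; apply/andP; split; last by move: vB; rewrite inE => /andP[].
  by apply: contraL vB => /KP[C /P2P CP vC]; apply: notB vC.
have DS : D \subset ~: S by rewrite -disjoints_subset disjoint_sym.
have LY : L \subset Y.
  apply/subsetP => v /(subsetP LD) vD; rewrite in_setD (subsetP DS) // andbT.
  by apply: contraL vD => /KP[C /P2P CP vC]; case/andP: (notSD C v CP vC).
have KS : K \subset ~: S.
  by apply/subsetP => v /KP[C /P2P CP vC]; rewrite in_setC; case/andP: (notSD C v CP vC).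
have leP1 : edges e L X <= #|P1|.
  rewrite edges_sym // edgesE -cX -sum1_card; apply: leq_sum => _ /imsetP[C CP1 ->].
  have [aC _] := aP C (P1P C CP1).
  by apply: leq_trans (deg1 C (a C) (P1P C CP1) aC); apply: subset_leq_card; apply: setIS.
have leP2 : #|P2| <= edges e D0 K.
  rewrite edges_sym // /edges big_trivIset; last by apply: trivIsetS tP; apply: subsetDl.
  rewrite -sum1_card; apply: leq_sum => C; rewrite inE => /andP[+ CP].
  by rewrite inE CP /= -lt0n edges_sym.
have eDS : edges e D (~: S) = \sum_(v in L) #|nbr e v| + (edges e D0 K + edges e D0 Y).
  rewrite -[in edges e D0 K](setIidPr KS) -edges_setID !edgesE (big_setID L) /= (setIidPr LD).
  congr (_ + _); apply: eq_bigr => v; rewrite inE disjoints_subset => /andP[_ nS].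
  by rewrite (setIidPl nS).
(* The inequality holds vertex by vertex over [Y]. A vertex of [L] has degree at least 2, and one in
   both [L] and [B] has two further incidences with [D0] and [X]; outside [L], a vertex of [B] needs
   two neighbours in [D0] alone. *)
have key : 2 * #|B| + 2 * #|L| <= edges e L X + \sum_(v in L) #|nbr e v| + edges e D0 Y.
  rewrite -!sum1_card edgesE -big_split (edges_sym _ _ eS) edgesE.
  rewrite (sum_subset _ BY) !(sum_subset _ LY) !big_distrr -!big_split /=.
  apply: leq_sum => v; rewrite in_setD in_setC => /andP[vK vS].
  have vB : v \in B -> 1 < #|nbr e v :&: D0| + #|nbr e v :&: X|.
    rewrite inE => /andP[_ /leq_trans]; apply; rewrite setIUr; exact: leq_card_setU.
  have := deg v; have [vL|vL _] := boolP (v \in L).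
    by case: (v \in B) vB => [/(_ isT)|_]; clear; lia.
  suff vB0 : v \in B -> 1 < #|nbr e v :&: D0|.
    by case: (v \in B) vB0 => [/(_ isT)|_]; clear; lia.
  (* A neighbour of [v] in [X] lies in a piece of [P1]. If [v] is in [D], it is in [D0], to which
     that piece has no edge; otherwise [v] lies in that piece, against [notB]. *)
  move=> vB'; have := vB vB'; suff -> : nbr e v :&: X = set0 by rewrite cards0 addn0.
  apply/setP => x; rewrite in_set0 in_setI [x \in nbr _ _]inE; apply/negP => /andP[vx /imsetP[C CP1 xE]].
  have CP := P1P C CP1; have [aC _] := aP C CP; rewrite -xE in aC.
  have [vD|vD] := boolP (v \in D).
    have := in_set0 v; rewrite -(P1N C x CP1 aC) in_setI in_setD vL vD andbT.
    by rewrite inE eS vx.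
  have xv : e x v by rewrite eS.
  by have := notB C v CP (closedP C x v CP aC xv vS vD); rewrite vB'.
have cD : #|D| = #|L| + #|D0| by rewrite -(cardsID L D) (setIidPr LD).
have cP : #|P| = #|P1| + #|P2|.
  by rewrite -(cardsID P1 P); congr (_ + _); apply: eq_card => C; rewrite !inE andbA andbb.
(* Twice [leZ], added to [key] and [leP1], gives [2|D0| + 2|L| + |P1| <= 2|S| + d + e(D0, Y)] with
   [d] the degree sum over [L]; with [leP2] this contradicts [ltP]. *)
by move: ltP leZ leP1 leP2 key; rewrite eDS cD cP cZ; clear; lia.
Qed.

Theorem theorem3p3 (T : finType) (e : rel T) (he : simple_graph e)
  (hconn : connected_graph e) (hcard : 3 <= #|T|)
  (hquad : s_quadrangular e) :
  exists f : rel T, two_factor e f.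
Proof.
have [eS eI] := he; have deg := quadrangular_degree eS hconn hcard hquad.
have [|//|[S [D [P oP]]]] := two_factor_or_obstruction he.
  by move=> u; have /card_gt0P[v] := ltnW (deg u); rewrite inE; exists v.
have [S' [D' [P' [oP' deg1 leave]]]] := tight_obstruction eS eI deg oP.
by case: (no_tight_obstruction eS (ltnW (ltnW hcard)) deg hquad oP' deg1 leave).
Qed.
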